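(* Let $n\ge 1$, let $B$ be a symmetric positive definite real matrix of order $n$, let $f:\mathbb{R}^n\to\mathbb{R}\cup\{+\infty\}$ be a convex, closed and proper function, let $\{\alpha_i\}_{i\geq 1}$ be a sequence of positive step sizes, let $R>0$, and let $x_0\in\mathbb{R}^n$ be an initial iterate satisfying $\|x_0-x_*\|_B\leq R$ for some minimizer $x_*$ of $f$ over $\mathbb{R}^n$. Let $\{x_i\}_{i\geq 1}$ be the sequence generated by the proximal point algorithm based on the norm $\|\cdot\|_B$ with step sizes $\{\alpha_i\}_{i\ge 1}$ applied to $f$ and started at $x_0$, i.e. $x_i=\operatorname{prox}_{\alpha_i f}(x_{i-1})$ for $i\ge 1$. Then for every $N\ge 1$ there exists a subgradient $g_N\in\partial f(x_N)$ such that $$\|g_N\|_{B^{-1}}\leq \frac{R}{\sum_{i=1}^{N}\alpha_i}.$$ In particular, $g_N=\frac{B(x_{N-1}-x_N)}{\alpha_N}$ is a subgradient of $f$ at $x_N$ satisfying this inequality.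
   Context: $\langle\cdot,\cdot\rangle$ is the standard dot product on $\mathbb{R}^n$. For the symmetric positive definite matrix $B$, $\|x\|_B=\sqrt{\langle Bx,x\rangle}$ and the dual norm is $\|u\|_{B^{-1}}=\sqrt{\langle u,B^{-1}u\rangle}$ for $x,u\in\mathbb{R}^n$. The function $f$ is extended real valued and not necessarily differentiable; closed means lower semicontinuous (closed epigraph), proper means not identically $+\infty$. The proximal mapping of $f$ with parameter $\alpha>0$ (based on $\|\cdot\|_B$) is $\operatorname{prox}_{\alpha f}(x)=\operatorname{argmin}_{y\in\mathbb{R}^n}\{\alpha f(y)+\frac12\|y-x\|_B^2\}$, which is uniquely well defined for every $x\in\mathbb{R}^n$ by strong convexity. $\partial f(x)$ denotes the convex subdifferential of $f$ at $x$ with respect to the standard dot product: the set of $g\in\mathbb{R}^n$ such that $f(y)\ge f(x)+\langle g,y-x\rangle$ for all $y\in\mathbb{R}^n$ (for $x$ with $f(x)<+\infty$). *)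

(* Defs.v *)
From HB Require Import structures.
From mathcomp Require Import all_boot all_order all_algebra.
From mathcomp Require Import all_classical all_reals all_analysis.

Set Implicit Arguments.
Unset Strict Implicit.
Unset Printing Implicit Defensive.

Import Order.TTheory GRing.Theory Num.Theory.
Import numFieldNormedType.Exports.

Local Open Scope classical_set_scope.
Local Open Scope ring_scope.

Definition dot (R : realType) (n : nat) (u v : 'cV[R]_n) : R :=
  \sum_(i < n) u i 0 * v i 0.

Definition posdefmx (R : realType) (n : nat) (B : 'M[R]_n) : Prop :=
  B \is symmetricmx /\ forall x : 'cV[R]_n, x != 0 -> 0 < dot (B *m x) x.

Definition normB (R : realType) (n : nat) (B : 'M[R]_n) (x : 'cV[R]_n) : R :=
  Num.sqrt (dot (B *m x) x).

Definition dualnormB (R : realType) (n : nat) (B : 'M[R]_n) (u : 'cV[R]_n) : R :=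
  Num.sqrt (dot u (invmx B *m u)).

Definition efun_convex (R : realType) (n : nat) (f : 'cV[R]_n -> \bar R) : Prop :=
  forall (x y : 'cV[R]_n) (t : R), 0 < t < 1 ->
    (f (t *: x + (1 - t) *: y)%R <= t%:E * f x + (1 - t)%:E * f y)%E.

(* A function into R `|` {+oo} is encoded as one into \bar R that never takes
   the value -oo. *)
Definition efun_proper (R : realType) (n : nat) (f : 'cV[R]_n -> \bar R) : Prop :=
  (forall x, f x != -oo%E) /\ (exists x, f x != +oo%E).

Definition argmin (R : realType) (n : nat) (F : 'cV[R]_n -> \bar R) :
    set 'cV[R]_n :=
  [set y | forall z, (F y <= F z)%E].

(* The proximal mapping is kept set-valued: for f convex, closed and proper and
   B positive definite this set is a singleton, and "p = prox_(alpha f) x" is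
   written [prox B alpha f x p]. *)
Definition prox (R : realType) (n : nat) (B : 'M[R]_n) (alpha : R)
    (f : 'cV[R]_n -> \bar R) (x : 'cV[R]_n) : set 'cV[R]_n :=
  argmin (fun y => alpha%:E * f y + (2^-1 * normB B (y - x)%R ^+ 2)%:E)%E.

Definition ppa_sequence (R : realType) (n : nat) (B : 'M[R]_n)
    (alpha : nat -> R) (f : 'cV[R]_n -> \bar R) (x : nat -> 'cV[R]_n) : Prop :=
  forall i : nat, (1 <= i)%N -> prox B (alpha i) f (x i.-1) (x i).

Definition subdifferential (R : realType) (n : nat) (f : 'cV[R]_n -> \bar R)
    (x : 'cV[R]_n) : set 'cV[R]_n :=
  [set g | (f x < +oo)%E /\
           forall y, (f x + (dot g (y - x)%R)%:E <= f y)%E].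

(* Main.v *)
Require Import Defs.
From HB Require Import structures.
From mathcomp Require Import all_boot all_order all_algebra.
From mathcomp Require Import all_classical all_reals all_analysis.
From mathcomp Require Import ring lra.

Set Implicit Arguments.
Unset Strict Implicit.
Unset Printing Implicit Defensive.

Import Order.TTheory GRing.Theory Num.Theory.
Import numFieldNormedType.Exports.

Local Open Scope classical_set_scope.
Local Open Scope ring_scope.

(** The proximal step is an implicit gradient step: optimality of [x i] says
    that [x i.-1 = x i + alpha i *: G i] where [B *m G i] is a subgradient of
    [f] at [x i] ([prox_subgradient]).  The bound is then the discrete form of
    an argument for the gradient flow [x' = - g], along which
    [t^2 |g|^2 + 2 t (f(x) - f(xs)) + |x - xs|^2] decreases.  With
    [S k] the sum of the first [k] step sizes, playing the role of time, the
    quantity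
      [E k = (S k)^2 |G k|^2 + 2 (S k) (f (x k) - f xs) + |x k - xs|^2]
    (norms being those of [B]) is nonincreasing for [k >= 1] and satisfies
    [E 1 <= |x 0 - xs|^2].  Writing [a] for the step size that leads from
    [x k] to [x k.+1], the decrease of [E] is the sum of three convexity
    inequalities:
    - the subgradient inequality from [x k.+1] to the minimizer [xs], with
      weight [2 a] ([ppa_descent]);
    - the subgradient inequality from [x k.+1] back to [x k], with weight
      [2 (S k)];
    - [|G k.+1|^2 <= |G k|^2], which is monotonicity of the subdifferential
      ([ppa_gradient_mono]), with weight [(S k)^2].
    All terms of [E N] being nonnegative, [(S N)^2 |G N|^2 <= |x 0 - xs|^2],
    and the norm of [G N] is the dual norm of the subgradient [B *m G N].
    As [S 0 = 0], the potential starts from [|x 0 - xs|^2] even when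
    [f (x 0)] is infinite. *)

(** * The inner product attached to [B] *)

Lemma dotC (R : realType) (n : nat) (u v : 'cV[R]_n) : dot u v = dot v u.
Proof. by apply: eq_bigr => i _; rewrite mulrC. Qed.

Lemma dotDl (R : realType) (n : nat) (u v w : 'cV[R]_n) :
  dot (u + v) w = dot u w + dot v w.
Proof. by rewrite -big_split; apply: eq_bigr => i _; rewrite mxE mulrDl. Qed.

Lemma dotZl (R : realType) (n : nat) (a : R) (u v : 'cV[R]_n) :
  dot (a *: u) v = a * dot u v.
Proof. by rewrite big_distrr; apply: eq_bigr => i _; rewrite mxE -mulrA. Qed.

Lemma dot_mx (R : realType) (n : nat) (u v : 'cV[R]_n) :
  dot u v = (u^T *m v) 0 0.
Proof. by rewrite mxE; apply: eq_bigr => i _; rewrite mxE. Qed.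

Definition dotB (R : realType) (n : nat) (B : 'M[R]_n) (u v : 'cV[R]_n) : R :=
  dot (B *m u) v.

Lemma dotBC (R : realType) (n : nat) (B : 'M[R]_n) (u v : 'cV[R]_n) :
  posdefmx B -> dotB B u v = dotB B v u.
Proof.
move=> [/is_hermitianmxP]; rewrite expr0 scale1r map_mx_id // => symB _.
by rewrite /dotB [RHS]dotC !dot_mx trmx_mul -mulmxA -symB.
Qed.

Lemma dotBDl (R : realType) (n : nat) (B : 'M[R]_n) (u v w : 'cV[R]_n) :
  dotB B (u + v) w = dotB B u w + dotB B v w.
Proof. by rewrite /dotB mulmxDr dotDl. Qed.

Lemma dotBZl (R : realType) (n : nat) (B : 'M[R]_n) (a : R) (u v : 'cV[R]_n) :
  dotB B (a *: u) v = a * dotB B u v.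
Proof. by rewrite /dotB -scalemxAr dotZl. Qed.

Lemma dotBDr (R : realType) (n : nat) (B : 'M[R]_n) (u v w : 'cV[R]_n) :
  dotB B u (v + w) = dotB B u v + dotB B u w.
Proof. by rewrite /dotB dotC dotDl ![dot _ (B *m u)]dotC. Qed.

Lemma dotBZr (R : realType) (n : nat) (B : 'M[R]_n) (a : R) (u v : 'cV[R]_n) :
  dotB B u (a *: v) = a * dotB B u v.
Proof. by rewrite /dotB dotC dotZl dotC. Qed.

Lemma dotB_sqrD (R : realType) (n : nat) (B : 'M[R]_n) (u v : 'cV[R]_n) :
  posdefmx B ->
  dotB B (u + v) (u + v) = dotB B u u + 2 * dotB B u v + dotB B v v.
Proof. by move=> Bpd; rewrite dotBDl !dotBDr [dotB B v u]dotBC //; ring. Qed.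

Lemma dotB_ge0 (R : realType) (n : nat) (B : 'M[R]_n) (u : 'cV[R]_n) :
  posdefmx B -> 0 <= dotB B u u.
Proof.
move=> [_ pdB]; have [->|u0] := eqVneq u 0; last exact/ltW/pdB.
by rewrite /dotB dotC dot_mx trmx0 mul0mx mxE.
Qed.

(** A row vector in the kernel of [B] would make the quadratic form vanish. *)
Lemma posdefmx_unit (R : realType) (n : nat) (B : 'M[R]_n) :
  posdefmx B -> B \in unitmx.
Proof.
move=> [_ pdB]; rewrite -unitmx_tr -row_free_unit -kermx_eq0.
apply/rowV0P => v /sub_kermxP vB0; apply/eqP/negP => v0.
have {pdB} := pdB v^T; rewrite trmx_eq0 => /(_ (introN idP v0)).
by rewrite -[B *m _]trmxK trmx_mul trmxK vB0 dot_mx trmxK mul0mx mxE ltxx.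
Qed.

Lemma normB_sqr (R : realType) (n : nat) (B : 'M[R]_n) (u : 'cV[R]_n) :
  posdefmx B -> normB B u ^+ 2 = dotB B u u.
Proof. by move=> Bpd; rewrite sqr_sqrtr //; exact: dotB_ge0. Qed.

Lemma dualnormB_mul (R : realType) (n : nat) (B : 'M[R]_n) (u : 'cV[R]_n) :
  posdefmx B -> dualnormB B (B *m u) = normB B u.
Proof. by move=> Bpd; rewrite /dualnormB mulKmx // posdefmx_unit. Qed.

(** * Optimality condition of the proximal step *)

Lemma argmin_fin_num (R : realType) (n : nat) (f : 'cV[R]_n -> \bar R)
    (p : 'cV[R]_n) :
  efun_proper f -> argmin f p -> f p \is a fin_num.
Proof.
move=> [fNy [z fz]] /(_ z) le_pz; rewrite fin_numE fNy /=.
by apply: contraNneq fz => fp; rewrite fp leye_eq in le_pz.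
Qed.

Lemma prox_fin_num (R : realType) (n : nat) (B : 'M[R]_n) (a : R)
    (f : 'cV[R]_n -> \bar R) (x p : 'cV[R]_n) :
  efun_proper f -> 0 < a -> prox B a f x p -> f p \is a fin_num.
Proof.
move=> [fNy [z fz]] a0 /(_ z) le_pz; rewrite fin_numE fNy /=.
apply/eqP => fp; move: le_pz (fNy z) fz; rewrite fp gt0_muley ?lte_fin //.
by case: (f z).
Qed.

(** First-order condition: letting [t] tend to [0].  Used with [u] the linear
    and [t * v] the quadratic part of the variation along a segment. *)
Lemma affine_ge0 (R : realType) (u v : R) :
  (forall t, 0 < t < 1 -> 0 <= u + t * v) -> 0 <= u.
Proof.
move=> H; rewrite leNgt; apply/negP => u0.
(* Any [t] with [t * `|v| < - u] contradicts the hypothesis; the extra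
   [- u] in the denominator makes it positive and [t < 1] even if [v = 0]. *)
pose t := (- u) / (2 * (`|v| + - u)).
have v0 : 0 <= `|v| := normr_ge0 v.
have vle := ler_norm v.
have d0 : 0 < 2 * (`|v| + - u) by lra.
have te : t * (2 * (`|v| + - u)) = - u by rewrite /t mulfVK // gt_eqF.
have t01 : 0 < t < 1.
  by rewrite divr_gt0 ?oppr_gt0 // ltr_pdivrMr // mul1r; lra.
have := H t t01; move/andP: t01 => [t0 t1].
have : t * v <= t * `|v| by rewrite ler_pM2l.
have : 0 < t * - u by rewrite mulr_gt0 ?oppr_gt0.
move: te; lra.
Qed.

(** Optimality of a proximal point, obtained without any calculus of
    subdifferentials: [p] is compared with the points [t *: y + (1 - t) *: p]
    of a segment, convexity bounds [f] there, and the remaining inequality,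
    divided by [t], is affine in [t]. *)
Lemma prox_subgradient (R : realType) (n : nat) (B : 'M[R]_n) (a : R)
    (f : 'cV[R]_n -> \bar R) (x p : 'cV[R]_n) :
  posdefmx B -> efun_convex f -> efun_proper f -> 0 < a ->
  prox B a f x p -> subdifferential f p (a^-1 *: (B *m (x - p))).
Proof.
move=> Bpd fcvx fpr a0 pp; have pfin := prox_fin_num fpr a0 pp.
split; first by rewrite ltey_eq pfin.
move=> y; case fy : (f y) => [Fy| |]; last 2 first.
- by rewrite leey.
- by case: fpr => /(_ y); rewrite fy.
move: pfin fcvx pp; case fp : (f p) => [Fp| |] // _ fcvx pp.
rewrite -EFinD lee_fin dotZl -/(dotB B (x - p) (y - p)).
set c := dotB _ _ _.
suff : 0 <= a * (Fy - Fp) - c.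
  move=> H; rewrite -(ler_pM2l a0) mulrDr mulrA divff ?gt_eqF // mul1r; lra.
apply: (@affine_ge0 _ _ (2^-1 * dotB B (y - p) (y - p))) => t t01.
have [t0 t1] := andP t01.
have := pp (t *: y + (1 - t) *: p).
have := fcvx y p t t01; rewrite fy fp !normB_sqr //.
have -> : t *: y + (1 - t) *: p - x = (p - x) + t *: (y - p).
  by rewrite scalerBl scale1r scalerBr addrCA addrAC.
rewrite (dotB_sqrD (p - x) (t *: _) Bpd) dotBZl !dotBZr.
have -> : dotB B (p - x) (y - p) = - c.
  by rewrite -opprB -scaleN1r dotBZl mulN1r.
case: fpr => /(_ (t *: y + (1 - t) *: p)%R) fNy _; move: fNy.
case: (f _) => [Fz| |] //= _; rewrite -!EFinM -!EFinD !lee_fin => cv le_pz.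
have {}cv : a * Fz <= a * (t * Fy + (1 - t) * Fp) by rewrite ler_pM2l.
rewrite -(pmulr_rge0 _ t0); lra.
Qed.

(** * The potential along the iterates *)

Lemma subdifferential_fine (R : realType) (n : nat) (B : 'M[R]_n)
    (f : 'cV[R]_n -> \bar R) (p y G : 'cV[R]_n) :
  f p \is a fin_num -> f y \is a fin_num -> subdifferential f p (B *m G) ->
  fine (f p) + dotB B G (y - p) <= fine (f y).
Proof.
by move=> pfin yfin [_ /(_ y)]; rewrite -(fineK pfin) -(fineK yfin) lee_fin.
Qed.

(** Subgradient inequality from [p] to [xs], once [|x - xs|^2] is expanded
    along [x = p + a *: G].  This is also the base case of the potential
    argument, for which [f x] may be infinite. *)
Lemma ppa_descent (R : realType) (n : nat) (B : 'M[R]_n)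
    (f : 'cV[R]_n -> \bar R) (a : R) (x p G xs : 'cV[R]_n) :
  posdefmx B -> 0 < a -> x = p + a *: G ->
  f p \is a fin_num -> f xs \is a fin_num -> subdifferential f p (B *m G) ->
  a ^+ 2 * dotB B G G + 2 * a * (fine (f p) - fine (f xs))
    + dotB B (p - xs) (p - xs) <= dotB B (x - xs) (x - xs).
Proof.
move=> Bpd a0 -> pfin sfin sub.
have := subdifferential_fine pfin sfin sub.
rewrite [p + _ - xs]addrAC (dotB_sqrD (p - xs) _ Bpd) dotBZl !dotBZr.
rewrite [dotB B (p - xs) G]dotBC //.
rewrite -[xs - p]opprB -scaleN1r dotBZr -(ler_pM2l a0); lra.
Qed.

(** Monotonicity of the subdifferential between [x] and [p], whose difference
    is proportional to [G], gives [<G, G> <= <H, G>]; then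
    [0 <= |H - G|^2] concludes. *)
Lemma ppa_gradient_mono (R : realType) (n : nat) (B : 'M[R]_n)
    (f : 'cV[R]_n -> \bar R) (a : R) (x p H G : 'cV[R]_n) :
  posdefmx B -> 0 < a -> x = p + a *: G ->
  f x \is a fin_num -> f p \is a fin_num ->
  subdifferential f x (B *m H) -> subdifferential f p (B *m G) ->
  dotB B G G <= dotB B H H.
Proof.
move=> Bpd a0 xE xfin pfin subx subp.
have hx := subdifferential_fine xfin pfin subx.
have hp := subdifferential_fine pfin xfin subp.
have px : p - x = - a *: G by rewrite xE opprD addrA subrr add0r scaleNr.
have xp : x - p = a *: G by rewrite -opprB px scaleNr opprK.
rewrite px dotBZr in hx; rewrite xp dotBZr in hp.
have GH : dotB B G G <= dotB B H G by rewrite -(ler_pM2l a0); lra.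
have := dotB_ge0 (H + -1 *: G) Bpd.
rewrite (dotB_sqrD _ _ Bpd) dotBZl !dotBZr; lra.
Qed.

(** The indices are shifted because [f] may be infinite, hence have no
    subgradient, at [x 0]. *)
Lemma ppa_potential (R : realType) (n : nat) (B : 'M[R]_n)
    (f : 'cV[R]_n -> \bar R) (a : nat -> R) (x G : nat -> 'cV[R]_n)
    (xs : 'cV[R]_n) (k : nat) :
  posdefmx B -> (forall i, 0 < a i.+1) ->
  (forall i, x i = x i.+1 + a i.+1 *: G i.+1) ->
  (forall i, f (x i.+1) \is a fin_num) -> f xs \is a fin_num ->
  (forall i, subdifferential f (x i.+1) (B *m G i.+1)) ->
  let S := \sum_(1 <= i < k.+2) a i in
  S ^+ 2 * dotB B (G k.+1) (G k.+1)
    + 2 * S * (fine (f (x k.+1)) - fine (f xs))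
    + dotB B (x k.+1 - xs) (x k.+1 - xs) <= dotB B (x 0%N - xs) (x 0%N - xs).
Proof.
move=> Bpd a0 xE xfin sfin sub.
elim: k => [|k /=]; first by rewrite big_nat1; exact: ppa_descent.
rewrite [in X in _ -> X]big_nat_recr //=; set S := \sum_(1 <= i < k.+2) a i.
have S0 : 0 <= S.
  rewrite /S big_nat_cond; apply: sumr_ge0 => -[//|i] _; exact/ltW.
have := ppa_gradient_mono Bpd (a0 _) (xE k.+1) (xfin _) (xfin _)
  (sub _) (sub _).
have := subdifferential_fine (xfin k.+1) (xfin k) (sub k.+1).
have := ppa_descent Bpd (a0 _) (xE k.+1) (xfin _) sfin (sub _).
have -> : x k.+1 - x k.+2 = a k.+2 *: G k.+2 by rewrite (xE k.+1) addrC addKr.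
rewrite dotBZr => H1 H2 H3 IH.
(* The three inequalities are summed with the weights [1], [2 * S], [S ^+ 2]:
   [a^2 + 2 * S * a] from the first two completes [S ^+ 2] to [(S + a) ^+ 2]. *)
have {}H2 := ler_wpM2l S0 H2; have {}H3 := ler_wpM2l (sqr_ge0 S) H3.
lra.
Qed.

Theorem corollary4p2 (R : realType) (n : nat) (n_ge1 : (1 <= n)%N)
    (B : 'M[R]_n) (B_posdef : posdefmx B)
    (f : 'cV[R]_n -> \bar R)
    (f_convex : efun_convex f) (f_closed : lower_semicontinuous f)
    (f_proper : efun_proper f)
    (alpha : nat -> R) (alpha_gt0 : forall i : nat, (1 <= i)%N -> 0 < alpha i)
    (r : R) (r_gt0 : 0 < r)
    (x : nat -> 'cV[R]_n)
    (x0_near : exists2 xs : 'cV[R]_n, argmin f xs & normB B (x 0%N - xs) <= r)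
    (x_ppa : ppa_sequence B alpha f x)
    (N : nat) (N_ge1 : (1 <= N)%N) :
  (exists2 g : 'cV[R]_n, subdifferential f (x N) g &
     dualnormB B g <= r / \sum_(1 <= i < N.+1) alpha i) /\
  (let gN := (alpha N)^-1 *: (B *m (x N.-1 - x N)) in
   subdifferential f (x N) gN /\
   dualnormB B gN <= r / \sum_(1 <= i < N.+1) alpha i).
Proof.
have [xs xs_min xs_near] := x0_near.
pose G i := (alpha i)^-1 *: (x i.-1 - x i).
have GE i : B *m G i = (alpha i)^-1 *: (B *m (x i.-1 - x i)).
  by rewrite /G -scalemxAr.
have sub i : subdifferential f (x i.+1) (B *m G i.+1).
  by rewrite GE; apply: prox_subgradient => //; [exact: alpha_gt0|exact: x_ppa].
have xfin i : f (x i.+1) \is a fin_num.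
  exact: prox_fin_num f_proper (alpha_gt0 _ _) (x_ppa i.+1 _).
have xE i : x i = x i.+1 + alpha i.+1 *: G i.+1.
  by rewrite /G scalerA divff ?gt_eqF ?alpha_gt0 // scale1r addrC subrK.
have sfin := argmin_fin_num f_proper xs_min.
suff bound : dualnormB B (B *m G N) <= r / \sum_(1 <= i < N.+1) alpha i.
  rewrite GE in bound; rewrite /=; split; last split=> //.
    by eexists; last exact: bound; rewrite -GE -(prednK N_ge1).
  by rewrite -GE -(prednK N_ge1).
case: N N_ge1 => // k _.
have S0 : 0 < \sum_(1 <= i < k.+2) alpha i.
  rewrite big_nat_recl // ltr_pwDl ?alpha_gt0 // sumr_ge0 // => i _.
  exact/ltW/alpha_gt0.
rewrite dualnormB_mul // ler_pdivlMr // mulrC.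
rewrite -ler_sqr ?nnegrE ?mulr_ge0 ?sqrtr_ge0 ?(ltW S0) ?(ltW r_gt0) //.
rewrite exprMn normB_sqr //.
have := ppa_potential k B_posdef (fun i => alpha_gt0 i.+1 isT) xE xfin sfin sub.
have : dotB B (x 0%N - xs) (x 0%N - xs) <= r ^+ 2.
  by rewrite -normB_sqr // ler_sqr ?nnegrE ?sqrtr_ge0 // ltW.
have := dotB_ge0 (x k.+1 - xs) B_posdef.
have : fine (f xs) <= fine (f (x k.+1)) by rewrite fine_le ?xfin.
by move=> /(ler_wpM2l (ltW S0)) /=; lra.
Qed.
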